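(* Let $T>0$ and $t_0\in[0,T/2]$, and let $\sigma(t_0,T)=\sup_{f\in\mathcal{L}_2(T)}f'(t_0)$. Then $$\sigma(t_0,T)=\begin{cases}2/T+T/2-t_0(T-t_0)/T & \text{if } t_0\le\sqrt2\ \text{and}\ T\le\sqrt{2t_0^2+4},\\ \sqrt{2t_0^2+4}-t_0 & \text{if } t_0\le\sqrt2\ \text{and}\ T>\sqrt{2t_0^2+4},\\ \sqrt2 & \text{if } t_0>\sqrt2.\end{cases}$$
   Context: For $T>0$, $\mathcal{L}_2(T)$ is the set of functions $f:[0,T]\to\mathbb{R}$ that are differentiable on $[0,T]$ (one-sided at the endpoints), with $f'$ absolutely continuous, such that $|f(t)|\le 1$ for all $t\in[0,T]$ and $|f''(t)|\le 1$ for almost every $t\in[0,T]$ (equivalently, $|f|\le1$ and $f'$ is $1$-Lipschitz). *)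

(* Defs.v *)
From HB Require Import structures.
From mathcomp Require Import all_boot all_order all_algebra.
From mathcomp Require Import all_classical all_reals all_analysis.
Set Implicit Arguments.
Unset Strict Implicit.
Unset Printing Implicit Defensive.
Import Order.TTheory GRing.Theory Num.Theory.
Import numFieldNormedType.Exports.
Local Open Scope classical_set_scope.
Local Open Scope ring_scope.

(* A function [0, T] -> R is represented by a total f : R -> R; every notion
   below depends only on the restriction of f to [0, T]. *)

(* The limits defining the derivative are taken along s -> t with s != t and
   s in [0, T]: two-sided inside the interval, one-sided at 0 and at T. *)
Definition diff_quotient (R : realType) (f : R -> R) (t s : R) : R :=
  (f s - f t) / (s - t).

Definition derivable_on (R : realType) (T : R) (f : R -> R) (t : R) : Prop :=
  cvg (diff_quotient f t @ within `[0, T] t^').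

Definition deriv_on (R : realType) (T : R) (f : R -> R) (t : R) : R :=
  lim (diff_quotient f t @ within `[0, T] t^').

Definition abs_continuous_on (R : realType) (T : R) (g : R -> R) : Prop :=
  forall e : R, 0 < e -> exists2 d : R, 0 < d &
    forall (n : nat) (u v : 'I_n -> R),
      (forall i, [/\ 0 <= u i, u i <= v i & v i <= T]) ->
      trivIset setT (fun i => [set` `]u i, v i[]) ->
      \sum_(i < n) (v i - u i) < d ->
      \sum_(i < n) `|g (v i) - g (u i)| < e.

(* In the last clause the existence of f'' almost everywhere is automatic from
   absolute continuity; it is spelled out because deriv_on is a total function
   with an unspecified value where the limit does not exist. *)
Definition L2 (R : realType) (T : R) : set (R -> R) :=
  [set f | [/\ forall t : R, t \in `[0, T] -> derivable_on T f t,
               abs_continuous_on T (deriv_on T f),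
               forall t : R, t \in `[0, T] -> `|f t| <= 1 &
               {ae @lebesgue_measure R, forall t : R, t \in `[0, T] ->
                 derivable_on T (deriv_on T f) t /\
                 `|deriv_on T (deriv_on T f) t| <= 1}]].

(* The supremum is taken in the extended reals. *)
Definition sigma (R : realType) (t0 T : R) : \bar R :=
  ereal_sup [set (deriv_on T f t0)%:E | f in L2 T].

(* Main.v *)
Require Import Defs.
From HB Require Import structures.
From mathcomp Require Import all_boot all_order all_algebra.
From mathcomp Require Import all_classical all_reals all_analysis.
From mathcomp Require Import ring lra.
Set Implicit Arguments.
Unset Strict Implicit.
Unset Printing Implicit Defensive.
Import Order.TTheory GRing.Theory Num.Theory.
Import numFieldNormedType.Exports.
Local Open Scope classical_set_scope.
Local Open Scope ring_scope.

(* Upper bound: f' is 1-Lipschitz, so Taylor's inequality at t0 gives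
   (b - a) f'(t0) <= f b - f a + ((b - t0)^2 + (t0 - a)^2) / 2 with
   f b - f a <= 2, whenever 0 <= a <= t0 <= b <= T.  The three cases are
   [a, b] = [0, T], [0, sqrt (2 t0^2 + 4)] and [t0 - sqrt 2, t0 + sqrt 2].
   Equality holds when f' t = max (0, M - |t - t0|) and f 0 = -1, M being the
   claimed supremum: then f is nondecreasing with f T = 1. *)

(* Cousin's lemma in the form of an induction on intervals: an additive
   interval property that holds locally at each point holds globally. *)
Lemma interval_induction (R : realType) (a b : R) (P : R -> R -> Prop) :
  a <= b ->
  (forall u v w, u <= v -> v <= w -> P u v -> P v w -> P u w) ->
  (forall x, a <= x <= b -> exists2 d, 0 < d &
     forall u v, a <= u -> u <= x -> x <= v -> v <= b -> v - u < d -> P u v) ->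
  P a b.
Proof.
move=> ab Ptrans Ploc.
pose S := [set x | a <= x <= b /\ P a x].
have Sa : S a.
  split; first by rewrite lexx.
  have [|d d0 H] := Ploc a; first by rewrite lexx.
  by apply: H => //; rewrite subrr.
have ubS : has_ubound S by exists b => x [/andP[]].
have supS : has_sup S by split => //; exists a.
have ac : a <= sup S by exact: ub_le_sup.
have cb : sup S <= b by apply: ge_sup; [exists a | move=> x [/andP[]]].
have [|d d0 H] := Ploc (sup S); first by rewrite ac cb.
have [|x Sx xc] := @sup_adherent _ S (d / 2) _ supS; first by lra.
have xS : x <= sup S by exact: ub_le_sup.
case: Sx => /andP[ax xb] Pax.
(* With [x] within [d / 2] below [sup S] and the new endpoint at most [d / 4] above it, the added
   interval is shorter than [d]; so [S] passes its supremum unless [b] cuts it off. *)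
have Pmin : P a (Num.min b (sup S + d / 4)).
  have cm : sup S <= Num.min b (sup S + d / 4) by rewrite le_min cb; lra.
  have md : Num.min b (sup S + d / 4) <= sup S + d / 4 by rewrite ge_min lexx orbT.
  have mb : Num.min b (sup S + d / 4) <= b by rewrite ge_min lexx.
  by apply: (Ptrans _ x) => //; [lra | apply: H => //; lra].
have [bd|db] := leP b (sup S + d / 4); first by move: Pmin; rewrite min_l.
have : sup S + d / 4 <= sup S.
  apply: ub_le_sup => //; split; first by apply/andP; split; lra.
  by move: Pmin; rewrite min_r // ltW.
by lra.
Qed.

(** * Derivatives relative to [[0, T]] *)

(** The division-free form admits [s = t] and makes sums and explicit error bounds direct;
    [has_deriv_on_cvgP] ties it to the limit. *)
Definition has_deriv_on (R : realType) (T : R) (f : R -> R) (t l : R) : Prop :=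
  forall e, 0 < e -> exists2 d, 0 < d &
    forall s, 0 <= s <= T -> `|s - t| < d ->
      `|f s - f t - l * (s - t)| <= e * `|s - t|.

(** Properness makes limits of difference quotients unique, so that [deriv_on] can be computed from
    [has_deriv_on]. *)
Lemma within_dnbhs_proper (R : realType) (T t : R) :
  0 < T -> 0 <= t <= T -> ProperFilter (within [set` `[0, T]] t^').
Proof.
move=> T0 /andP[t0 tT]; split; last exact: within_filter.
move=> /nbhs_ballP[e /= e0 H].
(* Moving towards the farther endpoint, by at most [T / 2], stays inside [[0, T]]. *)
have [tT2|tT2] := leP t (T / 2).
  pose m := Num.min (e / 2) (T / 2).
  have m0 : 0 < m by rewrite lt_min; apply/andP; split; lra.
  have me : m <= e / 2 by rewrite ge_min lexx.
  have mT : m <= T / 2 by rewrite ge_min lexx orbT.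
  apply: (H (t + m)); rewrite /ball /=.
  - by rewrite opprD addrA subrr sub0r normrN gtr0_norm //; lra.
  - by apply/eqP; lra.
  - by rewrite in_itv /=; apply/andP; split; lra.
pose m := Num.min (e / 2) (T / 2).
have m0 : 0 < m by rewrite lt_min; apply/andP; split; lra.
have me : m <= e / 2 by rewrite ge_min lexx.
have mT : m <= T / 2 by rewrite ge_min lexx orbT.
apply: (H (t - m)); rewrite /ball /=.
- by rewrite opprB addrC subrK gtr0_norm //; lra.
- by apply/eqP; lra.
- by rewrite in_itv /=; apply/andP; split; lra.
Qed.

Lemma has_deriv_on_cvgP (R : realType) (T : R) (f : R -> R) (t l : R) :
  has_deriv_on T f t l <->
  diff_quotient f t x @[x --> within `[0, T] t^'] --> l.
Proof.
split.
  move=> H; apply/cvgrPdist_le => e e0; have [d d0 {}H] := H e e0.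
  apply/nbhs_ballP; exists d => //= s; rewrite /ball /= => std st sT.
  rewrite distrC in std; rewrite in_itv /= in sT.
  have {}H := H s sT std.
  have st0 : s - t != 0 by rewrite subr_eq0.
  rewrite /diff_quotient distrC -[l](mulfK st0) -mulrBl normrM normfV.
  by rewrite ler_pdivrMr ?normr_gt0.
move=> /cvgrPdist_le H e e0; have /nbhs_ballP[d /= d0 {}H] := H e e0.
exists d => // s sT std.
have [->|st] := eqVneq s t; first by rewrite !subrr mulr0 subr0 normr0 mulr0.
have := H s; rewrite /ball /= distrC in_itv /= => /(_ std st sT).
have st0 : s - t != 0 by rewrite subr_eq0.
rewrite /diff_quotient distrC -[l in X in X -> _](mulfK st0) -mulrBl normrM.
by rewrite normfV ler_pdivrMr ?normr_gt0.
Qed.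

Lemma derivable_onP (R : realType) (T : R) (f : R -> R) (t : R) :
  0 < T -> 0 <= t <= T -> derivable_on T f t ->
  has_deriv_on T f t (deriv_on T f t).
Proof. by move=> T0 tT df; apply/has_deriv_on_cvgP. Qed.

Lemma has_deriv_on_derivable (R : realType) (T : R) (f : R -> R) (t l : R) :
  has_deriv_on T f t l -> derivable_on T f t.
Proof. by move=> /has_deriv_on_cvgP fl; apply/cvg_ex; exists l. Qed.

Lemma has_deriv_on_eq (R : realType) (T : R) (f : R -> R) (t l : R) :
  0 < T -> 0 <= t <= T -> has_deriv_on T f t l -> deriv_on T f t = l.
Proof.
move=> T0 tT /has_deriv_on_cvgP fl; have pf := within_dnbhs_proper T0 tT.
exact: cvg_lim.
Qed.

Lemma has_deriv_onD (R : realType) (T : R) (f g : R -> R) (t l m : R) :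
  has_deriv_on T f t l -> has_deriv_on T g t m ->
  has_deriv_on T (f \+ g) t (l + m).
Proof.
move=> fl gm e e0; have e20 : 0 < e / 2 by lra.
have [d d0 {}fl] := fl _ e20; have [c c0 {}gm] := gm _ e20.
exists (Num.min d c); first by rewrite lt_min d0.
move=> s sT; rewrite lt_min => /andP[/(fl s sT) H1 /(gm s sT) H2] /=.
rewrite (_ : _ - _ = (f s - f t - l * (s - t)) + (g s - g t - m * (s - t))).
  by rewrite (le_trans (ler_normD _ _)) //; lra.
by ring.
Qed.

Lemma has_deriv_on_quadratic_error (R : realType) (T C : R) (f : R -> R)
    (t l : R) :
  (forall s, `|f s - f t - l * (s - t)| <= C * (s - t) ^+ 2) ->
  has_deriv_on T f t l.
Proof.
(* The [+ 1] keeps the denominator positive when [C = 0]. *)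
move=> H e e0; exists (e / (`|C| + 1)); first by rewrite divr_gt0 // ltr_wpDl.
move=> s _; rewrite ltr_pdivlMr ?ltr_wpDl // => se.
rewrite (le_trans (H s)) // -real_normK ?num_real // expr2 mulrA.
rewrite ler_wpM2r // (le_trans _ (ltW se)) // mulrC ler_wpM2l //.
by rewrite (le_trans (ler_norm C)) // lerDl.
Qed.

Lemma has_deriv_on_quadratic (R : realType) (T t0 A B t : R) :
  has_deriv_on T (fun s => A * (s - t0) + B * (s - t0) ^+ 2) t
    (A + 2 * B * (t - t0)).
Proof.
apply: (@has_deriv_on_quadratic_error _ _ `|B|) => s.
rewrite (_ : _ - _ = B * (s - t) ^+ 2); last by ring.
by rewrite normrM (ger0_norm (sqr_ge0 _)).
Qed.

(** For each slack [e > 0] the bound [f u - f v <= e * (v - u)] is additive and holds near each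
    point, hence on the whole interval; then [e] tends to 0. *)
Lemma has_deriv_on_ge0_le (R : realType) (T : R) (f d : R -> R) (a b : R) :
  0 <= a -> a <= b -> b <= T ->
  (forall t, a <= t <= b -> has_deriv_on T f t (d t)) ->
  (forall t, a <= t <= b -> 0 <= d t) ->
  f a <= f b.
Proof.
move=> a0 ab bT fd d0.
have key e : 0 < e -> f a - f b <= e * (b - a).
  move=> e0; apply: (@interval_induction _ a b (fun u v => f u - f v <= e * (v - u))) => //.
    by move=> u v w uv vw; lra.
  move=> x xab; have [c c0 H] := fd x xab e e0; exists c => // u v au ux xv vb uvc.
  have := H u; rewrite ler0_norm ?subr_le0 // => /(_ _ _)/ler_normlP[||_ +].
  - by apply/andP; split; lra.
  - by lra.
  have := H v; rewrite (@ger0_norm _ (v - x)) ?subr_ge0 // => /(_ _ _)/ler_normlP[||+ _].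
  - by apply/andP; split; lra.
  - by lra.
  have : 0 <= d x * (v - x) by rewrite mulr_ge0 ?d0 // subr_ge0.
  have : 0 <= d x * (x - u) by rewrite mulr_ge0 ?d0 // subr_ge0.
  by lra.
rewrite -subr_le0; apply/ler_addgt0Pr => e e0; rewrite add0r.
apply: le_trans (key (e / (b - a + 1)) _) _; first by rewrite divr_gt0 //; lra.
rewrite mulrAC ler_pdivrMr; last by lra.
by rewrite ler_pM2l //; lra.
Qed.

(** * From absolute continuity and an almost everywhere derivative bound to a Lipschitz bound *)

(** Lists ordered from left to right can be concatenated, as the gluing step of an interval
    induction requires; the order makes the open intervals disjoint. *)
Lemma abs_continuous_on_seq (R : realType) (T : R) (g : R -> R) (e : R) :
  abs_continuous_on T g -> 0 < e ->
  exists2 d, 0 < d & forall s : seq (R * R),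
    all (fun I => [&& 0 <= I.1, I.1 <= I.2 & I.2 <= T]) s ->
    pairwise (fun I J => I.2 <= J.1) s ->
    \sum_(I <- s) (I.2 - I.1) < d ->
    \sum_(I <- s) `|g I.2 - g I.1| < e.
Proof.
move=> acg e0; have [d d0 H] := acg e e0.
exists d => // s /(all_nthP (0, 0)) s0T /(pairwiseP (0, 0)) s_pw sd.
rewrite big_tnth; rewrite big_tnth in sd.
apply: H sd.
  move=> i; rewrite (tnth_nth (0, 0)) /=.
  by have /and3P[] := s0T i (ltn_ord i).
have disj (i j : 'I_(size s)) x : (i < j)%N ->
    ~ (`](tnth (in_tuple s) i).1, (tnth (in_tuple s) i).2[%classic `&`
       `](tnth (in_tuple s) j).1, (tnth (in_tuple s) j).2[%classic) x.
  move=> ij; rewrite /= !in_itv /= => -[/andP[_ xi] /andP[jx _]].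
  have := s_pw i j (ltn_ord i) (ltn_ord j) ij.
  by move: xi jx; rewrite !(tnth_nth (0, 0)) /=; lra.
move=> i j _ _ [x [xi xj]]; have [ij|ji|/val_inj //] := ltngtP i j.
  by case: (disj i j x ij).
by case: (disj j i x ji).
Qed.

(* Apply interval induction to the increments of g, carrying along a finite
   family of disjoint intervals inside an open set U of small measure that
   contains the exceptional null set: near a good point the increment is
   controlled by the derivative, near a bad point a new interval is added. The
   increments over the family are then small by absolute continuity. *)
Lemma abs_continuous_on_lipschitz (R : realType) (T : R) (g : R -> R) (s t : R) :
  0 < T -> abs_continuous_on T g ->
  {ae @lebesgue_measure R, forall t : R, t \in `[0, T] ->
     derivable_on T g t /\ `|deriv_on T g t| <= 1} ->
  0 <= s -> s <= t -> t <= T -> `|g t - g s| <= t - s.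
Proof.
move=> T0 acg [N [mN N0 badN]] s0 st tT.
pose mu : {measure set (measurableTypeR R) -> \bar R} := lebesgue_measure.
have muN : mu N = 0%E := N0.
have key e : 0 < e -> `|g t - g s| <= (1 + e) * (t - s) + e.
  move=> e0; have [d d0 gd] := abs_continuous_on_seq acg e0.
  have [|U [oU NU mUN]] := lebesgue_regularity_outer mN _ d0.
    by rewrite muN ltry.
  have mU := measurable_realfun.open_measurable oU.
  (* Regularity only bounds the measure of [U] minus [N]; since [N] is null, the bound passes to
     [U]. *)
  have {mUN} mUd : (mu U < d%:E)%E.
    have UE : mu U = (mu (U `\` N) + mu (U `&` N))%E by exact: measureDI.
    rewrite UE; apply: le_lt_trans mUN.
    rewrite -[leRHS]adde0 leeD2l // -muN le_measure ?inE //.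
    exact: measurableI.
  (* Measuring [U] inside the open interval from [u] to [v] makes the third clause additive:
     adjacent open intervals are disjoint. *)
  pose P u v := exists r : seq (R * R),
    [/\ all (fun I => [&& u <= I.1, I.1 <= I.2 & I.2 <= v]) r,
        pairwise (fun I J => I.2 <= J.1) r,
        ((\sum_(I <- r) (I.2 - I.1))%:E <= mu (U `&` `]u, v[%classic))%E &
        `|g v - g u| <= (1 + e) * (v - u) + \sum_(I <- r) `|g I.2 - g I.1|].
  have [r [r_itv r_pw r_mu r_g]] : P s t.
    apply: interval_induction => //.
      move=> u v w uv vw [r [ri rp rm rg]] [q [qi qp qm qg]].
      exists (r ++ q); split.
      - rewrite all_cat; apply/andP; split.
          by apply: sub_all ri => I /and3P[-> -> Iv]; rewrite (le_trans Iv vw).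
        by apply: sub_all qi => I /and3P[vI -> ->]; rewrite (le_trans uv vI).
      - rewrite pairwise_cat rp qp !andbT; apply/allrelP => I J.
        move=> /(allP ri)/and3P[_ _ Iv] /(allP qi)/and3P[vJ _ _].
        exact: le_trans Iv vJ.
      - rewrite big_cat EFinD (le_trans (leeD rm qm)) //.
        rewrite -measureU; last 3 first.
        + by apply: measurableI => //; exact: measurable_itv.
        + by apply: measurableI => //; exact: measurable_itv.
        + apply/seteqP; split => // z [[_ zv] [_ vz]] /=.
          by move: zv vz; rewrite /= !in_itv /=; lra.
        apply: le_measure; rewrite ?inE.
        + by apply: measurableU; apply: measurableI => //; exact: measurable_itv.
        + by apply: measurableI => //; exact: measurable_itv.
        + move=> z [] [Uz]; rewrite /= !in_itv /= => /andP[zl zr].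
            by split=> //=; rewrite zl (lt_le_trans zr vw).
          by split=> //=; rewrite zr (le_lt_trans uv zl).
      - rewrite big_cat /= (_ : g w - g u = (g w - g v) + (g v - g u)).
          by rewrite (le_trans (ler_normD _ _)) //; lra.
        by rewrite addrA subrK.
    move=> x /andP[sx xt]; have [xN|xN] := pselect (N x).
      have /nbhs_ballP[r r0 rU] : nbhs x U by apply: open_nbhs_nbhs; split=> //; exact: NU.
      exists r => // u v su ux xv vt uvr; exists [:: (u, v)]; split.
      - by rewrite /= !lexx (le_trans ux xv).
      - by [].
      - rewrite big_seq1 /= setIidr; last first.
          move=> z; rewrite /= in_itv /= => /andP[uz zv]; apply: rU.
          by rewrite /ball /=; apply/ltr_normlP; split; lra.
        rewrite /mu lebesgue_measure_itv /= lte_fin; case: ltP => // vu.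
        by rewrite lee_fin subr_le0.
      - rewrite big_seq1 /= lerDr mulr_ge0 // ?subr_ge0; lra.
    have x0T : 0 <= x <= T by apply/andP; split; lra.
    have [dg dg1] : derivable_on T g x /\ `|deriv_on T g x| <= 1.
      apply: contrapT => bad; apply: xN; apply: badN => /= H; apply: bad.
      by apply: H; rewrite in_itv.
    have [r r0 H] := derivable_onP T0 x0T dg e0.
    have {}H z : 0 <= z <= T -> `|z - x| < r -> `|g z - g x| <= (1 + e) * `|z - x|.
      move=> zT zr; have := H z zT zr.
      have : `|deriv_on T g x * (z - x)| <= `|z - x|.
        by rewrite normrM ler_piMl.
      have := ler_normD (g z - g x - deriv_on T g x * (z - x)) (deriv_on T g x * (z - x)).
      by rewrite subrK; lra.
    exists r => // u v su ux xv vt uvr; exists [::]; split=> //.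
      by rewrite big_nil.
    rewrite big_nil addr0 (_ : g v - g u = (g v - g x) - (g u - g x)); last by ring.
    rewrite (le_trans (ler_normB _ _)) //.
    have := H u; rewrite ler0_norm ?subr_le0 // => /(_ _ _) hu.
    have := H v; rewrite (@ger0_norm _ (v - x)) ?subr_ge0 // => /(_ _ _) hv.
    have {}hu : `|g u - g x| <= (1 + e) * - (u - x).
      by apply: hu; [apply/andP; split|]; lra.
    have {}hv : `|g v - g x| <= (1 + e) * (v - x).
      by apply: hv; [apply/andP; split|]; lra.
    by lra.
  apply: (le_trans r_g); rewrite lerD2l ltW // gd //.
    apply: sub_all r_itv => I /and3P[sI II It].
    by rewrite II (le_trans s0 sI) (le_trans It tT).
  rewrite -lte_fin (le_lt_trans r_mu) // (le_lt_trans _ mUd) //.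
  by rewrite le_measure ?inE //; apply: measurableI.
apply/ler_addgt0Pr => e e0.
(* With this value the two error terms of [key] add up to exactly [e]. *)
have := key (e / (t - s + 1)); rewrite divr_gt0 ?ltr_wpDl ?subr_ge0 // => /(_ isT).
move/le_trans; apply; rewrite mulrDl mul1r -addrA lerD2l -[X in _ + X]mulr1 -mulrDr.
by rewrite mulfVK // gt_eqF // ltr_wpDl // subr_ge0.
Qed.

(** * Upper bound by Taylor's inequality *)

Lemma L2_deriv_on_le (R : realType) (T t0 a b : R) (f : R -> R) :
  0 < T -> 0 <= a -> a <= t0 -> t0 <= b -> b <= T -> L2 T f ->
  (b - a) * deriv_on T f t0 <= 2 + ((b - t0) ^+ 2 + (t0 - a) ^+ 2) / 2.
Proof.
move=> T0 a0 at0 t0b bT [df acf f1 aef].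
set m := deriv_on T f t0.
have lip s t : 0 <= s -> s <= t -> t <= T ->
    `|deriv_on T f t - deriv_on T f s| <= t - s.
  by move=> s0 st tT; exact: abs_continuous_on_lipschitz aef _ _ _.
(* Taylor's inequality by monotonicity: with [A = - m], and [B = - (1 / 2)] left of [t0] or
   [B = 1 / 2] right of it, the Lipschitz bound makes the derivative of the sum nonnegative, while
   the added term vanishes at [t0]. *)
have fD A B t : 0 <= t <= T ->
    has_deriv_on T (f \+ (fun s => A * (s - t0) + B * (s - t0) ^+ 2)) t
      (deriv_on T f t + (A + 2 * B * (t - t0))).
  move=> tT; apply: has_deriv_onD; last exact: has_deriv_on_quadratic.
  by apply: derivable_onP => //; apply: df; rewrite in_itv.
have in0T t : a <= t <= b -> 0 <= t <= T.
  by move=> /andP[lt tr]; apply/andP; split; lra.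
have left_le : f a + (- m * (a - t0) + - (1 / 2) * (a - t0) ^+ 2) <= f t0.
  have inl t : a <= t <= t0 -> a <= t <= b.
    by move=> /andP[-> tr]; rewrite (le_trans tr t0b).
  have := @has_deriv_on_ge0_le _ T _ _ a t0 a0 at0 (le_trans t0b bT)
    (fun t tT => fD (- m) (- (1 / 2)) t (in0T t (inl t tT))).
  rewrite /= subrr expr0n /= !mulr0 !addr0; apply.
  move=> t /andP[lt tr]; have /ler_normlP[] : `|m - deriv_on T f t| <= t0 - t by apply: lip; lra.
  by lra.
have right_le : f t0 <= f b + (- m * (b - t0) + (1 / 2) * (b - t0) ^+ 2).
  have inr t : t0 <= t <= b -> a <= t <= b.
    by move=> /andP[lt ->]; rewrite (le_trans at0 lt).
  have := @has_deriv_on_ge0_le _ T _ _ t0 b (le_trans a0 at0) t0b bT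
    (fun t tT => fD (- m) (1 / 2) t (in0T t (inr t tT))).
  rewrite /= subrr expr0n /= !mulr0 !addr0; apply.
  move=> t /andP[lt tr]; have /ler_normlP[] : `|deriv_on T f t - m| <= t - t0 by apply: lip; lra.
  by lra.
have /ler_normlP[fa _] : `|f a| <= 1.
  by apply: f1; rewrite in_itv /=; apply/andP; split; lra.
have /ler_normlP[_ fb] : `|f b| <= 1.
  by apply: f1; rewrite in_itv /=; apply/andP; split; lra.
by lra.
Qed.

Lemma sigma_le (R : realType) (T t0 a b m : R) :
  0 <= a -> a <= t0 -> t0 <= b -> b <= T -> a < b ->
  2 + ((b - t0) ^+ 2 + (t0 - a) ^+ 2) / 2 <= (b - a) * m ->
  (sigma t0 T <= m%:E)%E.
Proof.
move=> a0 at0 t0b bT ab le_m; apply: ge_ereal_sup => _ [f L2f <-].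
have T0 : 0 < T by lra.
rewrite lee_fin -(@ler_pM2l _ (b - a)) ?subr_gt0 //.
exact: le_trans (L2_deriv_on_le T0 a0 at0 t0b bT L2f) le_m.
Qed.

(** * The extremal function and its derivatives *)

(** The primitive of the positive part that vanishes at 0. *)
Definition half_sqr_pos (R : realType) (x : R) : R := Num.max 0 x ^+ 2 / 2.

Definition tent (R : realType) (t0 M t : R) : R := Num.max 0 (M - `|t - t0|).

(* The primitive of [tent t0 M] with value -1 at 0. *)
Definition extremal (R : realType) (t0 M t : R) : R :=
  half_sqr_pos (t - t0 + M) - 2 * half_sqr_pos (t - t0)
  + half_sqr_pos (t - t0 - M) - 1 - half_sqr_pos (M - t0).

(** Taylor's bound for a function with 1-Lipschitz derivative; it lets [extremal] be differentiated
    without locating [t] relative to the kinks. *)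
Lemma half_sqr_pos_error (R : realType) (s t : R) :
  `|half_sqr_pos s - half_sqr_pos t - Num.max 0 t * (s - t)|
    <= (s - t) ^+ 2 / 2.
Proof.
rewrite /half_sqr_pos; apply/ler_normlP.
have := sqr_ge0 s; have := sqr_ge0 t; have := sqr_ge0 (s - t).
case: (leP 0 s) => hs; case: (leP 0 t) => ht.
- by split; lra.
- by have := mulr_ge0_le0 hs (ltW ht); split; lra.
- by have := mulr_le0_ge0 (ltW hs) ht; split; lra.
- by split; lra.
Qed.

(** The tent is the second difference of the positive part with step [M], which matches [extremal]
    term by term. *)
Lemma tentE (R : realType) (t0 M t : R) : 0 <= M ->
  tent t0 M t =
  Num.max 0 (t - t0 + M) - 2 * Num.max 0 (t - t0) + Num.max 0 (t - t0 - M).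
Proof.
move=> M0; rewrite /tent.
case: (leP 0 (t - t0)) => h1; case: (leP 0 (t - t0 + M)) => h2;
  case: (leP 0 (t - t0 - M)) => h3; (try lra);
  case: (leP 0 (M - `|t - t0|)); rewrite ?(ger0_norm h1) ?(ltr0_norm h1); lra.
Qed.

Lemma tent_ge0 (R : realType) (t0 M t : R) : 0 <= tent t0 M t.
Proof. by rewrite /tent le_max lexx. Qed.

Lemma tent_lipschitz (R : realType) (t0 M s t : R) :
  `|tent t0 M t - tent t0 M s| <= `|t - s|.
Proof.
have := ler_dist_dist (t - t0) (s - t0).
rewrite opprB addrA subrK => /ler_normlP[h1 h2]; rewrite /tent.
apply/ler_normlP.
by case: (leP 0 (M - `|t - t0|)) => ?; case: (leP 0 (M - `|s - t0|)) => ?;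
  split; move: (normr_ge0 (t - s)); lra.
Qed.

Lemma has_deriv_on_extremal (R : realType) (T t0 M t : R) : 0 <= M ->
  has_deriv_on T (extremal t0 M) t (tent t0 M t).
Proof.
(* The weights 1, 2, 1 of the three shifted terms, each with error constant 1/2, add up to 2. *)
move=> M0; apply: (@has_deriv_on_quadratic_error _ _ 2) => s.
rewrite (tentE _ _ M0) /extremal.
have /ler_normlP[h1 h2] := half_sqr_pos_error (s - t0 + M) (t - t0 + M).
have /ler_normlP[h3 h4] := half_sqr_pos_error (s - t0) (t - t0).
have /ler_normlP[h5 h6] := half_sqr_pos_error (s - t0 - M) (t - t0 - M).
by apply/ler_normlP; split; lra.
Qed.

Lemma has_deriv_on_locally_affine (R : realType) (T d : R) (f : R -> R)
    (t l : R) :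
  0 < d -> (forall s, `|s - t| < d -> f s - f t = l * (s - t)) ->
  has_deriv_on T f t l.
Proof.
move=> d0 fE e e0; exists d => // s _ /fE ->.
by rewrite subrr normr0 mulr_ge0 // ltW.
Qed.

(** Away from its three kinks the tent is locally affine of slope 0, 1 or -1; this supplies the
    almost everywhere clause of [L2]. *)
Lemma has_deriv_on_tent (R : realType) (T t0 M t : R) : 0 < M ->
  t != t0 -> t != t0 - M -> t != t0 + M ->
  exists2 l, `|l| <= 1 & has_deriv_on T (tent t0 M) t l.
Proof.
move=> M0 ne0 neN neP.
have tent_out u : u <= t0 - M \/ t0 + M <= u -> tent t0 M u = 0.
  rewrite /tent => -[hu|hu]; apply/max_l; first by rewrite ler0_norm; lra.
  by rewrite ger0_norm; lra.
have tent_left u : t0 - M <= u -> u <= t0 -> tent t0 M u = M + (u - t0).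
  by move=> h1 h2; rewrite /tent ler0_norm ?max_r; lra.
have tent_right u : t0 <= u -> u <= t0 + M -> tent t0 M u = M - (u - t0).
  by move=> h1 h2; rewrite /tent ger0_norm ?max_r; lra.
have [t_lt|t_gt|tt] := ltgtP t t0; last by rewrite tt eqxx in ne0.
  have [t_ltN|t_gtN|tt] := ltgtP t (t0 - M); last by rewrite tt eqxx in neN.
    exists 0; first by rewrite normr0.
    apply: (@has_deriv_on_locally_affine _ _ (t0 - M - t)); first by lra.
    by move=> s /ltr_normlP[hs1 hs2]; rewrite !tent_out; [lra|left; lra|left; lra].
  exists 1; first by rewrite normr1.
  apply: (@has_deriv_on_locally_affine _ _ (Num.min (t - (t0 - M)) (t0 - t))).
    by rewrite lt_min; apply/andP; split; lra.
  move=> s; rewrite lt_min => /andP[/ltr_normlP[h1 h2] /ltr_normlP[h3 h4]].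
  by rewrite !tent_left; lra.
have [t_lt|t_gtP|tt] := ltgtP t (t0 + M); last by rewrite tt eqxx in neP.
  exists (-1); first by rewrite normrN1.
  apply: (@has_deriv_on_locally_affine _ _ (Num.min (t0 + M - t) (t - t0))).
    by rewrite lt_min; apply/andP; split; lra.
  move=> s; rewrite lt_min => /andP[/ltr_normlP[h1 h2] /ltr_normlP[h3 h4]].
  by rewrite !tent_right; lra.
exists 0; first by rewrite normr0.
apply: (@has_deriv_on_locally_affine _ _ (t - (t0 + M))); first by lra.
by move=> s /ltr_normlP[hs1 hs2]; rewrite !tent_out; [lra|right; lra|right; lra].
Qed.

(** Serves to differentiate [deriv_on T (extremal t0 M)], which is identified with [tent t0 M] on
    [[0, T]] only. *)
Lemma has_deriv_on_congr (R : realType) (T : R) (f g : R -> R) (t l : R) :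
  0 <= t <= T -> (forall s, 0 <= s <= T -> f s = g s) ->
  has_deriv_on T f t l -> has_deriv_on T g t l.
Proof.
move=> tT fg fl e e0; have [d d0 H] := fl e e0.
by exists d => // s sT; rewrite -!fg //; exact: H.
Qed.

(** * Admissibility of the extremal function and the lower bound *)

Lemma lipschitz_abs_continuous_on (R : realType) (T : R) (g : R -> R) :
  (forall s t, 0 <= s <= T -> 0 <= t <= T -> `|g t - g s| <= `|t - s|) ->
  abs_continuous_on T g.
Proof.
move=> lip e e0; exists e => // n u v uv _; apply: le_lt_trans.
apply: ler_sum => i _; have [u0 uvi vT] := uv i.
rewrite -[leRHS]ger0_norm ?subr_ge0 //.
by apply: lip; apply/andP; split=> //; [exact: le_trans uvi vT | exact: le_trans u0 uvi].
Qed.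

Lemma extremal0 (R : realType) (t0 M : R) :
  0 <= t0 -> 0 <= M -> extremal t0 M 0 = -1.
Proof.
move=> t00 M0; rewrite /extremal /half_sqr_pos sub0r (@addrC _ (- t0)).
rewrite (@max_l _ _ 0 (- t0)); last by lra.
rewrite (@max_l _ _ 0 (- t0 - M)); last by lra.
by ring.
Qed.

(** Since [extremal t0 M] is nondecreasing from -1 at 0, the single inequality at [T] keeps its
    values in [[-1, 1]]; its derivative at [t0] is the peak [M] of the tent. *)
Lemma sigma_ge (R : realType) (T t0 M : R) :
  0 < T -> 0 <= t0 -> t0 <= T -> 0 < M -> extremal t0 M T <= 1 ->
  (M%:E <= sigma t0 T)%E.
Proof.
move=> T0 t00 t0T M0 extT; have M0' := ltW M0.
have fD t : has_deriv_on T (extremal t0 M) t (tent t0 M t).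
  exact: has_deriv_on_extremal.
have f'E t : 0 <= t <= T -> tent t0 M t = deriv_on T (extremal t0 M) t.
  by move=> tT; rewrite (has_deriv_on_eq T0 tT (fD t)).
have f_le s t : 0 <= s -> s <= t -> t <= T -> extremal t0 M s <= extremal t0 M t.
  move=> s0 st tT; apply: has_deriv_on_ge0_le s0 st tT (fun u _ => fD u) _.
  by move=> u _; exact: tent_ge0.
apply: ereal_sup_ubound; exists (extremal t0 M); last first.
  by rewrite -f'E ?t00 // /tent subrr normr0 subr0 max_r.
split.
- by move=> t _; exact: has_deriv_on_derivable (fD t).
- apply: lipschitz_abs_continuous_on => s t sT tT.
  by rewrite -!f'E //; exact: tent_lipschitz.
- move=> t; rewrite in_itv /= => /andP[t_ge0 tT]; apply/ler_normlP; split.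
    by rewrite lerNl -(extremal0 t00 M0') f_le.
  exact: le_trans (f_le _ _ t_ge0 tT (lexx T)) extT.
have ctbl : countable [set t0; t0 - M; t0 + M].
  by apply: finite_set_countable; rewrite !finite_setU.
exists [set t0; t0 - M; t0 + M]; split.
- by apply: countable_measurable => // t; exact: measurable_set1.
- exact: countable_lebesgue_measure0.
- move=> t; apply: contra_notP => /= notK; rewrite in_itv /= => tT.
  have [|||l l1 tentD] := @has_deriv_on_tent _ T t0 M t M0.
  + by apply/eqP => tE; apply: notK; left; left.
  + by apply/eqP => tE; apply: notK; left; right.
  + by apply/eqP => tE; apply: notK; right.
  have {}tentD := has_deriv_on_congr tT f'E tentD.
  split; first exact: has_deriv_on_derivable tentD.
  by rewrite (has_deriv_on_eq T0 tT tentD).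
Qed.

Theorem proposition16 (R : realType) (T t0 : R)
    (hT : 0 < T) (ht0 : 0 <= t0) (ht0T : t0 <= T / 2) :
  [/\ t0 <= Num.sqrt 2 -> T <= Num.sqrt (2 * t0 ^+ 2 + 4) ->
        sigma t0 T = (2 / T + T / 2 - t0 * (T - t0) / T)%:E,
      t0 <= Num.sqrt 2 -> T > Num.sqrt (2 * t0 ^+ 2 + 4) ->
        sigma t0 T = (Num.sqrt (2 * t0 ^+ 2 + 4) - t0)%:E &
      t0 > Num.sqrt 2 ->
        sigma t0 T = (Num.sqrt 2)%:E].
Proof.
have t0_sqr : 0 <= t0 ^+ 2 by exact: sqr_ge0.
set S := Num.sqrt (2 * t0 ^+ 2 + 4).
have S0 : 0 < S by rewrite sqrtr_gt0; lra.
have SE : S ^+ 2 = 2 * t0 ^+ 2 + 4 by rewrite sqr_sqrtr; lra.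
set r2 := Num.sqrt 2.
have r2_gt0 : 0 < r2 by rewrite sqrtr_gt0.
have r2E : r2 ^+ 2 = 2 by rewrite sqr_sqrtr.
(* Squared, this is [t0 ^+ 2 <= 2]; it puts the left foot [t0 - (S - t0)] of the tent of the second
   case at or before 0. *)
have S_ge : t0 <= r2 -> 2 * t0 <= S.
  move=> t0_le; rewrite -(@ler_pXn2r _ 2) ?nnegrE ?(ltW S0) ?mulr_ge0 //.
  have : t0 ^+ 2 <= r2 ^+ 2 by rewrite lerXn2r // nnegrE ltW.
  by lra.
split=> [t0_le T_le|t0_le T_gt|t0_gt]; apply: le_anti; apply/andP; split.
- apply: (@sigma_le _ _ _ 0 T) => //; [lra|].
  by rewrite le_eqVlt; apply/orP; left; apply/eqP; field; lra.
- set M := 2 / T + T / 2 - t0 * (T - t0) / T.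
  have TM : T * M = 2 + T ^+ 2 / 2 - t0 * (T - t0) by rewrite /M; field; lra.
  have T_sqr : T ^+ 2 <= 2 * t0 ^+ 2 + 4 by rewrite -SE lerXn2r // ?nnegrE ltW.
  (* Equivalent to the bound [T_sqr]: the right foot [t0 + M] is at or beyond [T], and as
     [t0 <= T - t0] the left foot is at or before 0. *)
  have M_ge : T - t0 <= M by rewrite -(ler_pM2l hT) TM; lra.
  apply: sigma_ge => //; [lra|lra|].
  rewrite /extremal /half_sqr_pos (@max_r _ _ 0 (T - t0 + M)); last by lra.
  rewrite (@max_r _ _ 0 (T - t0)); last by lra.
  rewrite (@max_l _ _ 0 (T - t0 - M)); last by lra.
  rewrite (@max_r _ _ 0 (M - t0)); last by lra.
  by lra.
(* With [a = 0], the bound [(2 + ((b - t0) ^+ 2 + t0 ^+ 2) / 2) / b] is least at [b = S], with value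
   [S - t0]. *)
- by have := S_ge t0_le => ?; apply: (@sigma_le _ _ _ 0 S) => //; lra.
- move: S_ge => /(_ t0_le) S_ge.
  (* The right foot of this tent is [S < T], so the extremal function is constant on [[S, T]]. *)
  apply: sigma_ge => //; [lra|lra|].
  rewrite /extremal /half_sqr_pos (@max_r _ _ 0 (T - t0 + (S - t0))); last by lra.
  rewrite (@max_r _ _ 0 (T - t0)); last by lra.
  rewrite (@max_r _ _ 0 (T - t0 - (S - t0))); last by lra.
  rewrite (@max_r _ _ 0 (S - t0 - t0)); last by lra.
  by lra.
(* A symmetric interval of half-width [h] gives the bound [1 / h + h / 2], least at [h = r2]; it
   fits in [[0, T]] because [r2 < t0 <= T / 2]. *)
- by apply: (@sigma_le _ _ _ (t0 - r2) (t0 + r2)); lra.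
(* The whole tent now lies over [[0, T]], and its area [r2 ^+ 2 = 2] is the total rise from -1 to
   1. *)
- apply: sigma_ge => //; [lra|].
  rewrite /extremal /half_sqr_pos (@max_r _ _ 0 (T - t0 + r2)); last by lra.
  rewrite (@max_r _ _ 0 (T - t0)); last by lra.
  rewrite (@max_r _ _ 0 (T - t0 - r2)); last by lra.
  rewrite (@max_l _ _ 0 (r2 - t0)); last by lra.
  by lra.
Qed.
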